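(* For every positive integer $\mathfrak{s}$ there exists a locally finite tree $\mathcal T$ such that the number of siblings of $\mathcal T$, counted up to isomorphism, is exactly $\mathfrak{s}$, whether $\mathcal T$ is regarded as a binary relational structure (graph), so that its siblings range over all graphs, or regarded within the category of trees, so that its siblings range over trees only. Moreover, for $\mathfrak{s}=1$ the tree $\mathcal T$ can be taken so that it is not a ray and yet admits a non-surjective self-embedding.
   Context: Graphs are simple undirected graphs. An embedding of a graph $G$ into a graph $H$ is an injective map $f:V(G)\to V(H)$ such that for all $u,v\in V(G)$, $uv$ is an edge of $G$ if and only if $f(u)f(v)$ is an edge of $H$. A self-embedding is an embedding of $G$ into itself. Two graphs $G,H$ are equimorphic (siblings) if each embeds into the other. The sibling number of $G$ is the number of isomorphism classes of graphs equimorphic to $G$; when $G$ is a tree and one works in the category of trees, it is the number of isomorphism classes of trees equimorphic to $G$. A tree is locally finite if every vertex has finite degree. A ray is a one-way infinite path. *)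

(* Defs.v *)
From mathcomp Require Import all_boot.
From mathcomp Require Import boolp classical_sets functions cardinality.

Set Implicit Arguments.
Unset Strict Implicit.
Unset Printing Implicit Defensive.

Local Open Scope classical_set_scope.

Record sgraph := SGraph {
  vertex :> Type;
  edge : vertex -> vertex -> Prop;
  edge_sym : forall u v, edge u v -> edge v u;
  edge_irrefl : forall u, ~ edge u u
}.

Definition embedding (G H : sgraph) (f : G -> H) : Prop :=
  injective f /\ forall u v : G, edge u v <-> edge (f u) (f v).

Definition embeds (G H : sgraph) : Prop := exists f : G -> H, embedding f.

Definition equimorphic (G H : sgraph) : Prop := embeds G H /\ embeds H G.

Definition isomorphic (G H : sgraph) : Prop :=
  exists f : G -> H, bijective f /\ forall u v : G, edge u v <-> edge (f u) (f v).

(* [w] is only constrained on [0, n], where it is a walk of length [n]. *)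
Definition joined (G : sgraph) (u v : G) : Prop :=
  exists (n : nat) (w : nat -> G),
    [/\ w 0 = u, w n = v & forall i, i < n -> edge (w i) (w i.+1)].

Definition connected (G : sgraph) : Prop :=
  (exists u : G, True) /\ forall u v : G, joined u v.

(* [ordS] is the cyclic successor on ['I_n]. *)
Definition has_cycle (G : sgraph) : Prop :=
  exists (n : nat) (c : 'I_n -> G),
    [/\ 3 <= n, injective c & forall i : 'I_n, edge (c i) (c (ordS i))].

Definition is_tree (G : sgraph) : Prop := connected G /\ ~ has_cycle G.

Definition locally_finite (G : sgraph) : Prop :=
  forall u : G, finite_set [set v : G | edge u v].

Definition ray_edge (m n : nat) : Prop := n = m.+1 \/ m = n.+1.

Lemma ray_edge_sym m n : ray_edge m n -> ray_edge n m.
Proof. by case; [right | left]. Qed.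

Lemma ray_edge_irrefl n : ~ ray_edge n n.
Proof. by case=> /eqP; rewrite -[X in X == _]addn0 -addn1 eqn_add2l. Qed.

Definition ray : sgraph := SGraph ray_edge_sym ray_edge_irrefl.

Definition is_ray (G : sgraph) : Prop := isomorphic G ray.

Definition isoclass (G : sgraph) : set sgraph := [set H | isomorphic G H].

Definition siblings (C : set sgraph) (G : sgraph) : set sgraph :=
  [set H | C H /\ equimorphic G H].

(* [G] has exactly [s] siblings in [C], up to isomorphism; [C] is [setT] when
   siblings range over all graphs, and [is_tree] in the category of trees. *)
Definition sibling_number_is (C : set sgraph) (G : sgraph) (s : nat) : Prop :=
  (isoclass @` siblings C G #= `I_s)%card.

(* Main.v *)
Require Import Defs.
From mathcomp Require Import all_boot order ssralg ssrnum ssrint zify.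
From mathcomp Require Import boolp classical_sets functions cardinality.

(** The tree consists of a core, whose vertices ("hubs") are the pairs (g, n)
    with g in the free group on generators h_z (z in Z) and n in Z; the hub
    (g, n) is joined to (g, n+1), (g, n-1), (g h_n, n) and (g h_n^-1, n). Small
    numbers of leaves on subdivision vertices make these directions visible,
    which forces every self-embedding to be an automorphism of the core. Finally
    [label g] leaves are attached to each hub (g, 0). A labelling of the free
    group thus determines a tree, a sibling is given by a labelling squeezed
    between two translates of [label], and isomorphism is translation.

    The labelling is built so that every finite modification b of [label] is a
    translate of one of s standard ones. Enumerate the finite modifications by
    the generators; if the sum of [label] - b is j modulo s, then the generator
    h_z in charge of b must translate the standard labelling A_z, which lowers
    the value of [label] at the identity from s to s - j, to B_z = b. Such a
    labelling exists because the group is free: if h_z or h_z^-1 is the last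
    letter of maximal rank |z| of a reduced word and r is what follows it, the
    word receives the label A_z(r), respectively B_z(r). All translates of
    [label] differ from it by finite modifications of sum 0 modulo s, so the s
    standard labellings are pairwise inequivalent. *)

Set Implicit Arguments.
Unset Strict Implicit.
Unset Printing Implicit Defensive.

Local Open Scope classical_set_scope.

(** * Graphs and rooted trees *)

Lemma inj_surj_bijective (A B : Type) (f : A -> B) :
  injective f -> (forall y, exists x, f x = y) -> bijective f.
Proof.
move=> fI fS; have [g gK] := choice fS.
by exists g => // x; apply: fI; rewrite gK.
Qed.

Lemma bijective_surj (A B : Type) (f : A -> B) :
  bijective f -> forall y, exists x, f x = y.
Proof. by case=> g _ gK y; exists (g y). Qed.

Lemma embedding_comp (G H K : sgraph) (f : G -> H) (g : H -> K) :
  embedding f -> embedding g -> embedding (g \o f).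
Proof.
move=> [fI fE] [gI gE]; split; first exact: inj_comp.
by move=> u v; rewrite fE gE.
Qed.

Lemma embeds_trans (G H K : sgraph) : embeds G H -> embeds H K -> embeds G K.
Proof. by move=> [f fP] [g gP]; exists (g \o f); apply: embedding_comp. Qed.

Lemma isomorphic_refl (G : sgraph) : isomorphic G G.
Proof. by exists id; split=> //; exists id. Qed.

Lemma isomorphic_sym (G H : sgraph) : isomorphic G H -> isomorphic H G.
Proof.
move=> [f [[g fK gK] fE]]; exists g; split; first by exists f.
by move=> u v; rewrite fE !gK.
Qed.

Lemma isomorphic_trans (G H K : sgraph) :
  isomorphic G H -> isomorphic H K -> isomorphic G K.
Proof.
move=> [f [fB fE]] [g [gB gE]]; exists (g \o f); split; first exact: bij_comp.
by move=> u v; rewrite fE gE.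
Qed.

Lemma isomorphic_embeds (G H : sgraph) : isomorphic G H -> embeds G H.
Proof. by move=> [f [fB fE]]; exists f; split=> //; apply: bij_inj. Qed.

Lemma isoclass_eq (G H : sgraph) : isoclass G = isoclass H <-> isomorphic G H.
Proof.
split=> [GH|GH].
  by apply: isomorphic_sym; rewrite -[isomorphic H G]/(isoclass H G) -GH;
     apply: isomorphic_refl.
rewrite predeqP => K; split=> [GK|HK]; last exact: isomorphic_trans HK.
by apply: isomorphic_trans GK; apply: isomorphic_sym.
Qed.

Lemma joined_refl (G : sgraph) (u : G) : joined u u.
Proof. by exists 0, (fun=> u). Qed.

Lemma joined_edge (G : sgraph) (u v : G) : edge u v -> joined u v.
Proof.
move=> uv; exists 1, (fun i => if i == 0 then u else v).
by split=> // -[].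
Qed.

Lemma joined_trans (G : sgraph) (v u t : G) :
  joined u v -> joined v t -> joined u t.
Proof.
move=> [n [p [p0 pn pE]]] [m [q [q0 qm qE]]].
exists (n + m), (fun i => if i < n then p i else q (i - n)); split.
- case: n pn {pE} => [pn|n _] //=; by rewrite sub0n q0 -pn.
- by rewrite ltnNge leq_addr addnC addnK.
move=> i lt_i; case: (ltnP i n) => [lt_in|le_ni].
  case: (ltnP i.+1 n) => [_|le_nSi]; first exact: pE.
  have eqn : n = i.+1 by apply/eqP; rewrite eqn_leq le_nSi.
  by rewrite eqn subnn q0 -pn eqn; apply: pE; rewrite eqn.
rewrite ltnNge (leqW le_ni) /= subSn //; apply: qE.
by rewrite ltn_subLR.
Qed.

Lemma joined_sym (G : sgraph) (u v : G) : joined u v -> joined v u.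
Proof.
move=> [n [p [p0 pn pE]]]; exists n, (fun i => p (n - i)); split.
- by rewrite subn0.
- by rewrite subnn.
move=> i lt_in; apply: edge_sym.
have -> : n - i = (n - i.+1).+1 by rewrite subnSK.
by apply: pE; rewrite ltn_subrL (leq_ltn_trans _ lt_in).
Qed.

Section RootedTree.
Variables (G : sgraph) (root : G) (parent : G -> G) (depth : G -> nat).
Hypothesis edgeP : forall u v : G,
  edge u v <-> (u <> root /\ parent u = v) \/ (v <> root /\ parent v = u).
Hypothesis depth_parent : forall u, u <> root -> depth (parent u) < depth u.

Lemma joined_root u : joined u root.
Proof.
elim: {u}(depth u).+1 {-2}u (ltnSn (depth u)) => // n IHn u lt_un.
have [->|u_root] := pselect (u = root); first exact: joined_refl.
apply: (@joined_trans _ (parent u)).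
  by apply: joined_edge; apply/edgeP; left.
by apply: IHn; apply: leq_trans (depth_parent u_root) _.
Qed.

Lemma edge_parent u v : edge u v -> depth v <= depth u -> parent u = v.
Proof.
move=> /edgeP[[_ //]|[v_root <-]]; by rewrite leqNgt depth_parent.
Qed.

(* On a cycle, both neighbours of a deepest vertex would be its parent. *)
Lemma rooted_acyclic : ~ has_cycle G.
Proof.
move=> [n [c [n_ge3 cI cE]]].
have n_gt0 : 0 < n by apply: leq_trans n_ge3.
have [i _ i_max] := @arg_maxnP _ (Ordinal n_gt0) predT (fun i => depth (c i)) isT.
have next : parent (c i) = c (ordS i) by apply: edge_parent (cE i) (i_max _ isT).
have prev : parent (c i) = c (ord_pred i).
  apply: edge_parent (i_max _ isT); apply: edge_sym.
  by have := cE (ord_pred i); rewrite ord_predK.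
(* Applying [ordS] gives i + 2 = i modulo n, impossible for n >= 3; the cases below are the
   wrap-arounds. *)
have /(congr1 (@ordS n)) : ordS i = ord_pred i by apply: cI; rewrite -next.
rewrite ord_predK => /(congr1 val) /=.
have := ltn_ord i; case: (ltnP i.+1 n) => [lt1|le1] lt_in.
  rewrite (modn_small lt1); case: (ltnP i.+2 n) => [lt2|le2].
    by rewrite modn_small //; lia.
  have -> : i.+2 = n by lia.
  by rewrite modnn; lia.
have -> : i.+1 = n by lia.
by rewrite modnn modn_small; lia.
Qed.

Lemma rooted_is_tree : is_tree G.
Proof.
split; last exact: rooted_acyclic.
split; first by exists root.
by move=> u v; apply: joined_trans (joined_root u) (joined_sym (joined_root v)).
Qed.

End RootedTree.

(** Pigeonhole for a function that matters only below [a]; it serves to compare numbers of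
    leaves. *)
Lemma leq_inj_bound (a b : nat) (f : nat -> nat) :
  (forall k, k < a -> f k < b) ->
  (forall k l, k < a -> l < a -> f k = f l -> k = l) -> a <= b.
Proof.
move=> fb fI.
have fU : uniq [seq f k | k <- iota 0 a].
  rewrite map_inj_in_uniq ?iota_uniq // => k l.
  by rewrite !mem_iota => /= ka la; apply: fI.
have sub : {subset [seq f k | k <- iota 0 a] <= iota 0 b}.
  by move=> _ /mapP[k + ->]; rewrite !mem_iota => /= ka; apply: fb.
by have := uniq_leq_size fU sub; rewrite size_map !size_iota.
Qed.

Lemma inj_bound_surj (a : nat) (f : nat -> nat) :
  (forall k, k < a -> f k < a) ->
  (forall k l, k < a -> l < a -> f k = f l -> k = l) ->
  forall l, l < a -> exists2 k, k < a & f k = l.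
Proof.
move=> fb fI l la.
have fU : uniq [seq f k | k <- iota 0 a].
  rewrite map_inj_in_uniq ?iota_uniq // => k m.
  by rewrite !mem_iota => /= ka ma; apply: fI.
have sub : {subset [seq f k | k <- iota 0 a] <= iota 0 a}.
  by move=> _ /mapP[k + ->]; rewrite !mem_iota => /= ka; apply: fb.
have [_ eqs] := uniq_min_size fU sub (eq_leq (etrans (size_iota 0 a)
  (esym (etrans (size_map f _) (size_iota 0 a))))).
have : l \in iota 0 a by rewrite mem_iota.
by rewrite -eqs => /mapP[k]; rewrite mem_iota => /= ka ->; exists k.
Qed.

(** * Decorated trees *)

(** The first bit will separate multiplication by a letter ([true]) from a shift of the integer
    coordinate ([false]); the second bit is the sign. *)
Definition direction : Type := (bool * bool)%type.

Definition opp (i : direction) : direction := (i.1, ~~ i.2).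

Definition code (i : direction) : nat := i.1.*2 + i.2.

Lemma oppK : involutive opp.
Proof. by case=> a b; rewrite /opp /= negbK. Qed.

Lemma opp_neq i : i <> opp i.
Proof. by case: i => a [] []. Qed.

(** The direction of largest code must be fixed, then the next one, and so on; the proof runs
    through all maps on four directions. *)
Lemma code_increasing_id (p : direction -> direction) :
  injective p -> (forall i, code i <= code (p i)) -> forall i, p i = i.
Proof.
move=> pI p_le.
have ne i j : (i == j) = false -> (p i == p j) = false.
  by move=> ij; rewrite (inj_eq pI).
have := p_le (true, true); have := p_le (true, false).
have := p_le (false, true); have := p_le (false, false).
have := ne (true, true) (true, false) erefl.
have := ne (true, true) (false, true) erefl.
have := ne (true, true) (false, false) erefl.
have := ne (true, false) (false, true) erefl.
have := ne (true, false) (false, false) erefl.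
have := ne (false, true) (false, false) erefl.
move=> + + + + + + + + + + [[] []].
all: case: (p (true, true)) => -[] [].
all: case: (p (true, false)) => -[] [] //.
all: case: (p (false, true)) => -[] [] //.
all: by case: (p (false, false)) => -[] [].
Qed.

Section DecoratedTree.
Variables (V : Type) (nb : direction -> V -> V).
Hypothesis nbK : forall i v, nb (opp i) (nb i v) = v.

(* Each edge of the core is subdivided twice; [Mid v i] is the subdivision
   vertex next to [Hub v] in direction [i], and it carries [code i] leaves
   [ML v i k], so that directions can be read off from degrees. *)
Inductive node :=
  | Hub of V
  | Mid of V & direction
  | HL of V & nat
  | ML of V & direction & nat.

Definition nedge (x y : node) : Prop :=
  match x, y with
  | Hub v, Mid w _ | Mid v _, Hub w | Hub v, HL w _ | HL v _, Hub w => v = w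
  | Mid v i, ML w j _ | ML v i _, Mid w j => v = w /\ i = j
  | Mid v i, Mid w j => w = nb i v /\ j = opp i
  | _, _ => False
  end.

(** Cutting the leaves out of one common type lets vertices of trees with different labellings be
    compared through [val]. *)
Definition valid (l : V -> nat) (x : node) : bool :=
  match x with
  | HL v k => k < l v
  | ML _ i k => k < code i
  | _ => true
  end.

Lemma nedge_sym x y : nedge x y -> nedge y x.
Proof.
case: x y => [v|v i|v k|v i k] [w|w j|w m|w j m] //=.
- by move=> [-> ->]; rewrite nbK oppK.
- by move=> [-> ->].
- by move=> [-> ->].
Qed.

Lemma nedge_irrefl x : ~ nedge x x.
Proof. by case: x => [v|v i|v k|v i k] // [_]; apply: opp_neq. Qed.

Definition dtree (l : V -> nat) : sgraph :=
  @SGraph {x : node | valid l x} (fun x y => nedge (val x) (val y))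
    (fun x y => @nedge_sym (val x) (val y)) (fun x => @nedge_irrefl (val x)).

Definition hub l v : dtree l := exist (valid l) (Hub v) isT.
Definition mid l v i : dtree l := exist (valid l) (Mid v i) isT.
Definition hleaf l v k (kl : k < l v) : dtree l := exist (valid l) (HL v k) kl.
Definition mleaf l v i k (ki : k < code i) : dtree l :=
  exist (valid l) (ML v i k) ki.

Definition map_node (s : V -> V) (x : node) : node :=
  match x with
  | Hub v => Hub (s v)
  | Mid v i => Mid (s v) i
  | HL v k => HL (s v) k
  | ML v i k => ML (s v) i k
  end.

Lemma nedge_map (s : V -> V) : injective s ->
  (forall i v, s (nb i v) = nb i (s v)) ->
  forall x y, nedge x y <-> nedge (map_node s x) (map_node s y).
Proof.
move=> sI sE [v|v i|v k|v i k] [w|w j|w m|w j m] //=;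
  rewrite -?sE; split=> //;
  by [move/sI | move=> -> | move=> [/sI-> ->] | move=> [-> ->]].
Qed.

Lemma map_node_inj s : injective s -> injective (map_node s).
Proof.
by move=> sI [v|v i|v k|v i k] [w|w j|w m|w j m] //= [/sI-> *]; subst.
Qed.

Section MapTree.
Variables (l l' : V -> nat) (s : V -> V).
Hypothesis sI : injective s.
Hypothesis sE : forall i v, s (nb i v) = nb i (s v).
Hypothesis l_le : forall v, l v <= l' (s v).

Lemma valid_map x : valid l x -> valid l' (map_node s x).
Proof. by case: x => //= v k kl; apply: leq_trans (l_le v). Qed.

Definition map_dtree (x : dtree l) : dtree l' :=
  exist (valid l') (map_node s (val x)) (valid_map (valP x)).

Lemma map_dtree_embedding : embedding map_dtree.
Proof.
split=> [x y /(congr1 val) /= /(map_node_inj sI)|x y]; first exact: val_inj.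
exact: nedge_map.
Qed.

End MapTree.

Lemma dtree_embeds l l' s : injective s ->
  (forall i v, s (nb i v) = nb i (s v)) -> (forall v, l v <= l' (s v)) ->
  embeds (dtree l) (dtree l').
Proof. by move=> sI sE le; exists (map_dtree le); apply: map_dtree_embedding. Qed.

Lemma dtree_isomorphic l l' s : bijective s ->
  (forall i v, s (nb i v) = nb i (s v)) -> (forall v, l v = l' (s v)) ->
  isomorphic (dtree l) (dtree l').
Proof.
move=> sB sE eql; have sI := bij_inj sB.
have le v : l v <= l' (s v) by rewrite eql.
have [fI fE] := map_dtree_embedding sI sE le.
exists (map_dtree le); split=> //; apply: inj_surj_bijective => // y.
have sS := bijective_surj sB.
have [x xy] : exists x, map_node s x = val y.
  case: (val y) => [v|v i|v k|v i k]; have [u <-] := sS v.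
  - by exists (Hub u).
  - by exists (Mid u i).
  - by exists (HL u k).
  - by exists (ML u i k).
have xl : valid l x.
  have := valP y; rewrite /= -xy; by case: x {xy} => //= v k; rewrite eql.
by exists (exist _ x xl); apply: val_inj.
Qed.

(** * Rigidity of embeddings of decorated trees *)

Section Embedding.
Variables (l l' : V -> nat) (f : dtree l -> dtree l').
Hypothesis f_emb : embedding f.

Let fI : injective f. Proof. by case: f_emb. Qed.

Let fE (x y : dtree l) : nedge (val x) (val y) -> nedge (val (f x)) (val (f y)).
Proof. by case: f_emb => _ /(_ x y) [+ _]; apply. Qed.

Let f_neq (x y : dtree l) : val x <> val y -> val (f x) <> val (f y).
Proof. by move=> xy /val_inj/fI xy'; apply: xy; rewrite xy'. Qed.

Definition leaf (x : node) : bool :=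
  match x with HL _ _ | ML _ _ _ => true | _ => false end.

Lemma leaf_nedge_uniq x y z : leaf x -> nedge x y -> nedge x z -> y = z.
Proof.
case: x y z => [v|v i|v k|v i k] [w|w j|w m|w j m] [u|u n|u n|u n p] //= _.
  by move=> <- <-.
by move=> [<- <-] [<- <-].
Qed.

Lemma emb_nonleaf (x y z : dtree l) : nedge (val x) (val y) -> nedge (val x) (val z) ->
  val y <> val z -> leaf (val (f x)) = false.
Proof.
move=> xy xz yz; apply/negP => lx.
exact: f_neq yz (leaf_nedge_uniq lx (fE xy) (fE xz)).
Qed.

Lemma emb_mid_nonleaf v i : leaf (val (f (mid l v i))) = false.
Proof. by apply: (@emb_nonleaf _ (hub l v) (mid l (nb i v) (opp i))). Qed.

Lemma emb_hub_nonleaf v : leaf (val (f (hub l v))) = false.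
Proof.
by apply: (@emb_nonleaf _ (mid l v (true, true)) (mid l v (false, true))).
Qed.

(** The subdivision vertices around a hub have non-leaf images, and a subdivision vertex has only
    two non-leaf neighbours: too few for three distinct images. *)
Lemma emb_hubP v : exists w, val (f (hub l v)) = Hub w.
Proof.
have := emb_hub_nonleaf v; case E : (val (f (hub l v))) => [w|w i|//|//] _.
  by exists w.
have two j : val (f (mid l v j)) = Hub w \/
             val (f (mid l v j)) = Mid (nb i w) (opp i).
  have /fE : nedge (val (hub l v)) (val (mid l v j)) by [].
  have := emb_mid_nonleaf v j; rewrite E.
  by case: (val (f (mid l v j))) => //= [u _ ->|u k _ [-> ->]]; [left|right].
have dif i1 i2 : i1 <> i2 -> val (f (mid l v i1)) <> val (f (mid l v i2)).
  by move=> i12; apply: f_neq => -[].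
have d1 := dif (true, true) (true, false) ltac:(by []).
have d2 := dif (true, true) (false, false) ltac:(by []).
have d3 := dif (true, false) (false, false) ltac:(by []).
case: (two (true, true)) (two (true, false)) (two (false, false)) d1 d2 d3.
all: by move=> -> [] -> [] ->.
Qed.

Definition node_hub (x : node) : V :=
  match x with Hub v | Mid v _ | HL v _ | ML v _ _ => v end.
Definition node_dir (x : node) : direction :=
  match x with Mid _ i | ML _ i _ => i | _ => (true, true) end.

Definition hub_map v : V := node_hub (val (f (hub l v))).
Let dir_map v i : direction := node_dir (val (f (mid l v i))).

Lemma emb_hub v : val (f (hub l v)) = Hub (hub_map v).
Proof. by rewrite /hub_map; have [w ->] := emb_hubP v. Qed.

Let emb_mid_dir v i : val (f (mid l v i)) = Mid (hub_map v) (dir_map v i).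
Proof.
have /fE : nedge (val (hub l v)) (val (mid l v i)) by [].
rewrite emb_hub /dir_map; have := emb_mid_nonleaf v i.
by case: (val (f (mid l v i))) => //= w j _ ->.
Qed.

Let f_nb v i : hub_map (nb i v) = nb (dir_map v i) (hub_map v) /\
  dir_map (nb i v) (opp i) = opp (dir_map v i).
Proof.
have /fE : nedge (val (mid l v i)) (val (mid l (nb i v) (opp i))) by [].
by rewrite !emb_mid_dir.
Qed.

(** Apart from its leaves, a subdivision vertex has two neighbours, and here both are already images
    of other vertices. *)
Let emb_mleaf_dir v i k (ki : k < code i) : exists2 k',
  k' < code (dir_map v i) &
  val (f (mleaf l v ki)) = ML (hub_map v) (dir_map v i) k'.
Proof.
have /fE : nedge (val (mid l v i)) (val (mleaf l v ki)) by [].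
rewrite emb_mid_dir.
have nh : val (f (mleaf l v ki)) <> val (f (hub l v)) by apply: f_neq.
have nm : val (f (mleaf l v ki)) <> val (f (mid l (nb i v) (opp i))).
  exact: f_neq.
move: nh nm; rewrite emb_hub emb_mid_dir; have [-> ->] := f_nb v i.
have := valP (f (mleaf l v ki)).
case: (val _) => [w|w j|w m|w j m] //=.
- by move=> _ nh _ eqw; case: nh; rewrite eqw.
- by move=> _ _ nm [ew ej]; case: nm; rewrite ew ej.
by move=> mj _ _ [-> ->]; exists m.
Qed.

(** The leaves of a subdivision vertex inject into those of its image, so [dir_map v] never
    decreases codes. *)
Let dir_map_id v i : dir_map v i = i.
Proof.
apply: (code_increasing_id (p := dir_map v)) => [j j' eqj|j].
  suff /fI/(congr1 val)[] : f (mid l v j) = f (mid l v j') by [].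
  by apply: val_inj; rewrite !emb_mid_dir eqj.
have /choice[h hP] : forall k, exists k', k < code j ->
    k' < code (dir_map v j) /\ exists kj : k < code j,
    val (f (mleaf l v kj)) = ML (hub_map v) (dir_map v j) k'.
  move=> k; have [kj|nkj] := pselect (k < code j); last by exists 0 => /nkj.
  by have [k' k'j Ek'] := emb_mleaf_dir v kj; exists k' => _; split=> //; exists kj.
apply: (@leq_inj_bound _ _ h) => [k /hP[]//|k m kj mj hkm].
have [_ [k_ Ek]] := hP k kj; have [_ [m_ Em]] := hP m mj.
have /val_inj/fI/(congr1 val)[] // : val (f (mleaf l v k_)) = val (f (mleaf l v m_)).
by rewrite Ek Em hkm.
Qed.

Lemma emb_mid v i : val (f (mid l v i)) = Mid (hub_map v) i.
Proof. by rewrite emb_mid_dir dir_map_id. Qed.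

Lemma hub_map_nb i v : hub_map (nb i v) = nb i (hub_map v).
Proof. by have [-> _] := f_nb v i; rewrite dir_map_id. Qed.

Lemma emb_mleaf v i k (ki : k < code i) : exists2 k', k' < code i &
  val (f (mleaf l v ki)) = ML (hub_map v) i k'.
Proof. by have := emb_mleaf_dir v ki; rewrite dir_map_id. Qed.

Lemma emb_hleaf v k (kl : k < l v) : exists2 k', k' < l' (hub_map v) &
  val (f (hleaf kl)) = HL (hub_map v) k'.
Proof.
have /fE : nedge (val (hub l v)) (val (hleaf kl)) by [].
have nm i : val (f (hleaf kl)) <> val (f (mid l v i)) by apply: f_neq.
rewrite emb_hub; move: nm; have := valP (f (hleaf kl)).
case: (val _) => [w|w j|w m|w j m] //=.
  by move=> _ nm eqw; case: (nm j); rewrite emb_mid eqw.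
by move=> ml _ ew; exists m; rewrite ew.
Qed.

(** A subdivision vertex and its image carry the same finite number of leaves, so the injection
    between these is onto. *)
Lemma mleaf_onto v i k : k < code i -> exists x, val (f x) = ML (hub_map v) i k.
Proof.
have /choice[h hP] : forall k, exists k', k < code i ->
    k' < code i /\ exists kj : k < code i,
    val (f (mleaf l v kj)) = ML (hub_map v) i k'.
  move=> m; have [mi|nmi] := pselect (m < code i); last by exists 0 => /nmi.
  by have [m' m'i Em'] := emb_mleaf v mi; exists m' => _; split=> //; exists mi.
move=> ki; have [m|m n mi ni hmn|m mi <-] := @inj_bound_surj _ h _ _ k ki.
- by case/hP.
- have [_ [m_ Em]] := hP m mi; have [_ [n_ En]] := hP n ni.
  have /val_inj/fI/(congr1 val)[] // : val (f (mleaf l v m_)) = val (f (mleaf l v n_)).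
  by rewrite Em En hmn.
by have [_ [m_ Em]] := hP m mi; exists (mleaf l v m_).
Qed.

Lemma hub_map_label v : l v <= l' (hub_map v).
Proof.
have /choice[h hP] : forall k, exists k', k < l v ->
    k' < l' (hub_map v) /\ exists kl : k < l v,
    val (f (hleaf kl)) = HL (hub_map v) k'.
  move=> k; have [kl|nkl] := pselect (k < l v); last by exists 0 => /nkl.
  by have [k' k'l Ek'] := emb_hleaf kl; exists k' => _; split=> //; exists kl.
apply: (@leq_inj_bound _ _ h) => [k /hP[]//|k m kl ml hkm].
have [_ [k_ Ek]] := hP k kl; have [_ [m_ Em]] := hP m ml.
have /val_inj/fI/(congr1 val)[] // : val (f (hleaf k_)) = val (f (hleaf m_)).
by rewrite Ek Em hkm.
Qed.

End Embedding.

Hypothesis nb_connected : forall P : V -> Prop, (exists v, P v) ->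
  (forall i v, P v -> P (nb i v)) -> forall v, P v.

(** The set of hubs that are hit is nonempty and closed under [nb]. An embedding can therefore miss
    only hub leaves. *)
Lemma hub_map_surj l l' (f : dtree l -> dtree l') : embedding f ->
  inhabited V -> forall w, exists v, hub_map f v = w.
Proof.
move=> fP [v0]; apply: nb_connected; first by exists (hub_map f v0), v0.
by move=> i _ [v <-]; exists (nb i v); apply: hub_map_nb.
Qed.

Lemma dtree_isomorphicP l l' : isomorphic (dtree l) (dtree l') ->
  exists s : V -> V, [/\ forall i v, s (nb i v) = nb i (s v),
    forall v, l v <= l' (s v) & forall v, l' (s v) <= l v].
Proof.
move=> [f [fB fE]]; have [g fK gK] := fB.
have fP : embedding f by split=> //; apply: bij_inj.
have gP : embedding g.
  by split=> [|u v]; [exact: can_inj gK | rewrite fE !gK].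
exists (hub_map f); split=> [i v|v|v].
- exact: hub_map_nb.
- exact: hub_map_label.
suff /(congr1 (fun w => l w)) <- : hub_map g (hub_map f v) = v.
  exact: hub_map_label.
have -> : hub_map g (hub_map f v) = node_hub (val (g (f (hub l v)))).
  by rewrite /hub_map; congr (node_hub (val (g _))); apply: val_inj; rewrite emb_hub.
by rewrite fK.
Qed.

(** * Siblings of a decorated tree *)

Section Sandwich.
Variables (l : V -> nat) (H : sgraph) (f : dtree l -> H) (g : H -> dtree l).
Hypotheses (fP : embedding f) (gP : embedding g).

Let gf_emb : embedding (g \o f) := embedding_comp fP gP.
Let X (x : node) : Prop := exists y, val (g y) = x.

Definition sandwich_leaves v : seq nat :=
  [seq k <- iota 0 (l v) | `[< X (HL v k) >]].
Definition sandwich_label v : nat := size (sandwich_leaves v).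

Let uniq_leaves v : uniq (sandwich_leaves v).
Proof. by rewrite filter_uniq ?iota_uniq. Qed.

Let to_node (x : node) : node :=
  if x is HL v k then HL v (nth 0 (sandwich_leaves v) k) else x.

Let to_node_inj x y : valid sandwich_label x -> valid sandwich_label y ->
  to_node x = to_node y -> x = y.
Proof.
case: x y => [v|v i|v k|v i k] [w|w j|w m|w j m] //= kv mw [vw]; subst w.
by move=> /eqP; rewrite nth_uniq // => /eqP->.
Qed.

Let nedge_to_node x y : nedge x y <-> nedge (to_node x) (to_node y).
Proof. by case: x y => [v|v i|v k|v i k] [w|w j|w m|w j m]. Qed.

Lemma sandwich_label_le v : sandwich_label v <= l v.
Proof.
by rewrite /sandwich_label size_filter (leq_trans (count_size _ _)) ?size_iota.
Qed.

Let surj : inhabited V -> forall w, exists v, hub_map (g \o f) v = w.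
Proof. exact: hub_map_surj. Qed.

(** Since [g \o f] hits everything except possibly hub leaves, the image of [g], a copy of [H], is
    the tree with some hub leaves removed; [to_node] sends consecutive indices to the surviving
    ones. *)
Lemma sandwich_isomorphic : isomorphic (dtree sandwich_label) H.
Proof.
have toX x : valid sandwich_label x -> X (to_node x).
  case: x => [v|v i|v k|v i k] /= xl.
  - have [u <-] := surj (inhabits v) v.
    by exists (f (hub l u)); apply: (emb_hub gf_emb).
  - have [u <-] := surj (inhabits v) v.
    by exists (f (mid l u i)); apply: (emb_mid gf_emb).
  - have /(mem_nth 0) : k < size (sandwich_leaves v) by [].
    by rewrite mem_filter => /andP[/asboolP].
  - have [u <-] := surj (inhabits v) v.
    by have [x Ex] := mleaf_onto gf_emb u xl; exists (f x).
have /choice[h hP] : forall x : dtree sandwich_label, exists y,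
    val (g y) = to_node (val x) by move=> x; apply: toX; apply: valP.
exists h; split=> [|x y].
  apply: inj_surj_bijective => [x y hxy|y].
    apply: val_inj; apply: to_node_inj; [exact: valP|exact: valP|].
    by rewrite -!hP hxy.
  suff [x xl Ex] : exists2 x, valid sandwich_label x & to_node x = val (g y).
    exists (exist _ x xl); have [gI _] := gP; apply: gI; apply: val_inj.
    by rewrite hP.
  have := valP (g y); case Ey : (val (g y)) => [v|v i|v k|v i k] /= kl.
  - by exists (Hub v).
  - by exists (Mid v i).
  - have kX : k \in sandwich_leaves v.
      by rewrite mem_filter mem_iota /= add0n kl andbT; apply/asboolP; exists y.
    exists (HL v (index k (sandwich_leaves v))).
      by rewrite /= /sandwich_label index_mem.
    by rewrite /to_node nth_index.
  - by exists (ML v i k).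
have [_ ->] := gP; rewrite /= !hP; exact: nedge_to_node.
Qed.

End Sandwich.

Lemma dtree_sibling l H : equimorphic (dtree l) H ->
  exists l', (forall v, l' v <= l v) /\ isomorphic (dtree l') H.
Proof.
move=> [[f fP] [g gP]]; exists (sandwich_label g).
by split=> [v|]; [exact: sandwich_label_le | exact: sandwich_isomorphic fP gP].
Qed.

Lemma dtree_locally_finite l : locally_finite (dtree l).
Proof.
move=> x; pose B := match val x with
  | Hub v => Mid v @` setT `|` HL v @` `I_(l v)
  | Mid v i => [set Hub v; Mid (nb i v) (opp i)] `|` ML v i @` `I_(code i)
  | HL v _ => [set Hub v]
  | ML v i _ => [set Mid v i]
  end.
have finB : finite_set B.
  rewrite /B; case: (val x) => [v|v i|v _|v i _].
  - rewrite finite_setU; split; apply: finite_image; last exact: finite_II.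
    exact: finite_finset.
  - rewrite finite_setU; split; first exact: finite_set2.
    by apply: finite_image; apply: finite_II.
  - exact: finite_set1.
  - exact: finite_set1.
apply: (@sub_finite_set _ _ (val @^-1` B)); last first.
  by apply: finite_preimage finB => ? ? _ _; apply: val_inj.
move=> y; have := valP y; rewrite /B /=.
case: (sval x) (sval y) => [v|v i|v k|v i k] [w|w j|w m|w j m] //=.
- by move=> _ ->; left; exists j.
- by move=> ml ->; right; exists m.
- by move=> _ ->; left; left.
- by move=> _ [-> ->]; left; right.
- by move=> mi [-> ->]; right; exists m.
- by move=> _ ->.
- by move=> _ [-> ->].
Qed.

(** * Rooting the decorated tree *)

Variables (root : V) (is_root : pred V).
Variables (up : V -> direction) (height : V -> nat).
Hypothesis is_rootP : forall v, reflect (v = root) (is_root v).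
Hypothesis upP : forall i v, ~~ is_root v && (i == up v) =
  ~~ (~~ is_root (nb i v) && (opp i == up (nb i v))).
Hypothesis height_up : forall v, ~~ is_root v -> height (nb (up v) v) < height v.

Definition to_root v i : bool := ~~ is_root v && (i == up v).

Definition node_parent (x : node) : node :=
  match x with
  | Hub v => Mid v (up v)
  | Mid v i => if to_root v i then Mid (nb i v) (opp i) else Hub v
  | HL v _ => Hub v
  | ML v i _ => Mid v i
  end.

(** The factor 3 reflects the two subdivisions of each core edge. The predecessor is not truncated,
    since a hub with a rootward direction has positive height. *)
Definition node_depth (x : node) : nat :=
  match x with
  | Hub v => 3 * height v
  | Mid v i => if to_root v i then (3 * height v).-1 else (3 * height v).+1
  | HL v _ => (3 * height v).+1
  | ML v _ _ => (3 * height v).+2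
  end.

Lemma valid_parent l x : valid l (node_parent x).
Proof. by case: x => //= v i; case: ifP. Qed.

Lemma nedge_parent x : nedge x (node_parent x).
Proof. by case: x => //= v i; case: ifP. Qed.

Lemma to_rootN i v : to_root v i = ~~ to_root (nb i v) (opp i).
Proof. exact: upP. Qed.

Lemma nedgeP x y : nedge x y <->
  (x <> Hub root /\ node_parent x = y) \/ (y <> Hub root /\ node_parent y = x).
Proof.
split; last first.
  by case=> -[_ <-]; [|apply: nedge_sym]; apply: nedge_parent.
have hub_mid v i : (Hub v <> Hub root /\ Mid v (up v) = Mid v i) \/
    (Mid v i <> Hub root /\ node_parent (Mid v i) = Hub v).
  rewrite /=; case: (boolP (to_root v i)) => [/andP[/is_rootP vr /eqP->]|_].
    by left; split=> // -[].
  by right.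
case: x y => [v|v i|v k|v i k] [w|w j|w m|w j m] //
  => [<-|<-|<-|[-> ->]|[<- <-]|<-|[<- <-]].
- exact: hub_mid.
- by right.
- by case: (hub_mid v i); [right|left].
- rewrite /= nbK oppK (to_rootN i v).
  by case: (to_root (nb i v) (opp i)) => /=; [right|left].
- by right.
- by left.
- by left.
Qed.

Lemma node_depth_parent x : x <> Hub root ->
  node_depth (node_parent x) < node_depth x.
Proof.
case: x => [v|v i|v k|v i k] //=.
- move=> vr; have /is_rootP nvr : v <> root by move=> vE; apply: vr; rewrite vE.
  have := height_up nvr; rewrite /to_root nvr eqxx /=; lia.
- move=> _; case: (boolP (to_root v i)) => [ti|_] //=.
  have := to_rootN i v; rewrite ti => /esym/negbTE ->.
  by move: ti => /andP[/height_up + /eqP ->]; lia.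
- by case: ifP; lia.
Qed.

Lemma dtree_is_tree l : is_tree (dtree l).
Proof.
have rootE (x : dtree l) : x <> hub l root <-> val x <> Hub root.
  by split=> [h xr|h xr]; [apply: h; apply: val_inj | apply: h; rewrite xr].
pose par (x : dtree l) : dtree l := exist (valid l) _ (valid_parent l (val x)).
apply: (@rooted_is_tree _ (hub l root) par (node_depth \o val)) => [x y|x].
  have parE (u t : dtree l) : par u = t <-> node_parent (val u) = val t.
    by split=> [<-|ut]; [|apply: val_inj].
  by rewrite !rootE !parE; apply: nedgeP.
by rewrite rootE => /node_depth_parent.
Qed.

End DecoratedTree.

(** * Reduced words and the core *)

(** [(z, true)] is the generator h_z and [(z, false)] its inverse. *)
Definition letter : Type := (int * bool)%type.

Definition inv_letter (a : letter) : letter := (a.1, ~~ a.2).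

Lemma inv_letterK : involutive inv_letter.
Proof. by case=> z b; rewrite /inv_letter /= negbK. Qed.

(* Words are stored backwards: the head of the list is the last letter. *)
Definition red (w : seq letter) : bool := sorted (fun a b => b != inv_letter a) w.

Definition word : Type := {w : seq letter | red w}.

Definition rms (c : letter) (w : seq letter) : seq letter :=
  if w is b :: w' then if b == inv_letter c then w' else c :: w else [:: c].

Lemma red_behead a w : red (a :: w) -> red w.
Proof. by case: w => //= b w /andP[]. Qed.

Lemma red_rms c w : red w -> red (rms c w).
Proof.
case: w => //= b w bw; case: ifP => [_|/negbT bc]; first exact: red_behead bw.
by rewrite /red /= bc.
Qed.

(** If [c] cancels the head, reducedness of the word keeps the new head from cancelling when the old
    one is put back. *)
Lemma rmsK c w : red w -> rms (inv_letter c) (rms c w) = w.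
Proof.
case: w => [_|b w bw] /=; first by rewrite inv_letterK eqxx.
case: (eqVneq b (inv_letter c)) bw => [-> | _ _] /=; last by rewrite inv_letterK eqxx.
by case: w => //= a w /andP[]; rewrite inv_letterK => /negbTE->.
Qed.

Lemma rms_red c w : red (c :: w) -> rms c w = c :: w.
Proof. by case: w => //= b w /andP[/negbTE-> _]. Qed.

Lemma foldr_rms u v : red (u ++ v) -> foldr rms v u = u ++ v.
Proof.
elim: u => //= c u IHu cuv; rewrite IHu ?rms_red //.
exact: red_behead cuv.
Qed.

Lemma red_catl u v : red (u ++ v) -> red u.
Proof. by case: u => //= a u; rewrite /red /= cat_path => /andP[]. Qed.

Lemma red_rcons2 u b a :
  red (rcons u b) -> b != inv_letter a -> red (rcons (rcons u b) a).
Proof.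
move=> ub ba; have ab : a != inv_letter b.
  by apply: contraNneq ba => ->; rewrite inv_letterK.
case: u ub => [|c u] /=; first by rewrite /red /= ab.
by rewrite /red /= => cub; rewrite rcons_path cub last_rcons.
Qed.

Definition empty : word := exist red [::] isT.
Definition single (a : letter) : word := exist red [:: a] isT.
Definition rm (c : letter) (w : word) : word :=
  exist red (rms c (val w)) (red_rms c (valP w)).

Lemma rmK c w : rm (inv_letter c) (rm c w) = w.
Proof. by apply: val_inj; rewrite /= rmsK //; apply: valP. Qed.

Lemma rmVK c w : rm c (rm (inv_letter c) w) = w.
Proof. by rewrite -{1}(inv_letterK c) rmK. Qed.

Lemma word_ind (P : word -> Prop) :
  P empty -> (forall c w, P w -> P (rm c w)) -> forall w, P w.
Proof.
move=> P0 PS [w]; elim: w => [|c w IHw] cw.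
  by rewrite (_ : exist _ _ _ = empty) //; apply: val_inj.
have wr := red_behead cw.
suff -> : exist _ (c :: w) cw = rm c (exist _ w wr) by apply: PS.
by apply: val_inj; rewrite /= rms_red.
Qed.

Definition wmul (g w : word) : word := foldr rm g (val w).

Lemma val_wmul g w : val (wmul g w) = foldr rms (val g) (val w).
Proof. by rewrite /wmul; elim: (val w) => //= c u ->. Qed.

Lemma wmul_rm g c w : wmul g (rm c w) = rm c (wmul g w).
Proof.
rewrite /wmul /=; case: (val w) => //= b u.
by case: eqP => // ->; rewrite rmVK.
Qed.

(** A map commuting with right multiplications is a left translation; this replaces explicit
    associativity arguments. *)
Lemma rm_morph_eq (p q : word -> word) :
  (forall c w, p (rm c w) = rm c (p w)) -> (forall c w, q (rm c w) = rm c (q w)) ->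
  p empty = q empty -> p =1 q.
Proof.
by move=> pE qE pq; apply: word_ind => // c w IHw; rewrite pE qE IHw.
Qed.

Definition lm (a : letter) (w : word) : word := wmul (single a) w.

Lemma lm_rm a c w : lm a (rm c w) = rm c (lm a w). Proof. exact: wmul_rm. Qed.

Lemma wmul_rml g c w : wmul (rm c g) w = wmul g (lm c w).
Proof.
move: w; apply: rm_morph_eq => [b w|b w|].
- exact: wmul_rm.
- by rewrite lm_rm wmul_rm.
- by [].
Qed.

Lemma wmul0 w : wmul empty w = w.
Proof. by move: w; apply: rm_morph_eq => // c w; apply: wmul_rm. Qed.

Lemma lmK a : cancel (lm a) (lm (inv_letter a)).
Proof.
move=> w; rewrite /lm -wmul_rml -[RHS]wmul0; congr wmul.
by apply: val_inj; rewrite /= eqxx.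
Qed.

Lemma lmVK a : cancel (lm (inv_letter a)) (lm a).
Proof. by move=> w; rewrite -{1}(inv_letterK a) lmK. Qed.

Lemma lm_bij a : bijective (lm a).
Proof. by exists (lm (inv_letter a)); [exact: lmK|exact: lmVK]. Qed.

(** The first letter of a word is the end of its list, so left multiplication cancels or appends
    there. *)
Lemma val_lm_rcons a w u b : val w = rcons u b ->
  val (lm a w) = if b == inv_letter a then u else rcons (rcons u b) a.
Proof.
move=> wE; have ub : red (rcons u b) by rewrite -wE; apply: valP.
rewrite val_wmul wE foldr_rcons /=.
have -> : (a == inv_letter b) = (b == inv_letter a).
  by apply/eqP/eqP => ->; rewrite inv_letterK.
case: ifP => [_|/negbT ba].
  by rewrite foldr_rms cats0 //; move: ub; rewrite -cats1; apply: red_catl.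
by rewrite foldr_rms; rewrite -cat_rcons cats1 // red_rcons2.
Qed.

Lemma val_lm_nil a w : val w = [::] -> val (lm a w) = [:: a].
Proof. by move=> wE; rewrite val_wmul wE. Qed.

(** * The core and its root *)

Definition hubs : Type := (word * int)%type.

(** The integer coordinate selects the one generator available at a hub, so four directions suffice
    for infinitely many generators. *)
Definition nbh (i : direction) (v : hubs) : hubs :=
  if i.1 then (rm (v.2, i.2) v.1, v.2)
  else (v.1, if i.2 then (v.2 + 1)%R else (v.2 - 1)%R).

Lemma nbhK i v : nbh (opp i) (nbh i v) = v.
Proof.
case: i v => [[] b] [w n]; rewrite /nbh /=.
  by rewrite (_ : (n, ~~ b) = inv_letter (n, b)) ?rmK.
by congr pair; case: b => /=; lia.
Qed.

Definition hroot : hubs := (empty, 0%R).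

Lemma nbh_connected (P : hubs -> Prop) : (exists v, P v) ->
  (forall i v, P v -> P (nbh i v)) -> forall v, P v.
Proof.
move=> [v0 Pv0] PS.
have shift w n m : P (w, n) -> P (w, m).
  have upn k : P (w, n) -> P (w, (n + k%:Z)%R).
    elim: k => [|k IHk] Pn; first by rewrite GRing.addr0.
    have := PS (false, true) _ (IHk Pn); rewrite /nbh /=.
    by congr (P (_, _)); lia.
  have dnn k : P (w, n) -> P (w, (n - k%:Z)%R).
    elim: k => [|k IHk] Pn; first by rewrite GRing.subr0.
    have := PS (false, false) _ (IHk Pn); rewrite /nbh /=.
    by congr (P (_, _)); lia.
  move=> Pn; case E : (m - n)%R => [k|k].
    by have := upn k Pn; congr (P (_, _)); lia.
  (* The successor appears because [Negz k] is -(k + 1). *)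
  by have := dnn k.+1 Pn; congr (P (_, _)); lia.
(* The letter [c] is applied at level [c.1], and [shift] then reaches every other level. *)
have step c w : (forall n, P (w, n)) -> forall n, P (rm c w, n).
  move=> Pw n; apply: (@shift _ c.1); case: c => z b.
  exact: PS (true, b) _ (Pw z).
have P0 n : P (empty, n).
  case: v0 Pv0 => w m /(shift w m n).
  suff H : forall w n, P (w, n) -> P (empty, n) by exact: H.
  apply: word_ind => // c u IHu k Pk; apply: IHu.
  have /(_ k) := step (inv_letter c) (rm c u) (fun i => shift _ _ i Pk).
  by rewrite rmK.
case=> w n; move: w n; apply: word_ind => // c w; exact: step.
Qed.

(** The level where the line of hubs over a word meets the line over the word without its last
    letter. The way to the root shifts to this level and then cancels that letter. *)
Definition base (w : seq letter) : int := if w is a :: _ then a.1 else 0%R.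

Definition is_hroot (v : hubs) : bool := v == hroot.

Definition uph (v : hubs) : direction :=
  if v.2 == base (val v.1) then
    (true, if val v.1 is a :: _ then ~~ a.2 else true)
  else (false, (v.2 < base (val v.1))%R).

Fixpoint word_height (w : seq letter) (n : int) : nat :=
  if w is a :: w' then `|n - a.1| + (word_height w' a.1).+1 else `|n|.

Definition hheight (v : hubs) : nat := word_height (val v.1) v.2.

Lemma is_hrootP v : reflect (v = hroot) (is_hroot v).
Proof. exact: eqP. Qed.

Lemma is_hrootE v : is_hroot v = (val v.1 == [::]) && (v.2 == 0%R).
Proof. by case: v => w n; rewrite /is_hroot xpair_eqE -val_eqE. Qed.

Lemma uph_letter b (w : word) n :
  ~~ is_hroot (w, n) && ((true, b) == uph (w, n)) = (ohead (val w) == Some (n, ~~ b)).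
Proof.
rewrite is_hrootE /uph /=; case: (sval w) => [|[z c] u] /=.
  by case: (n == 0)%R.
rewrite (_ : Some (z, c) == _ = ((z, c) == (n, ~~ b))) // xpair_eqE (eq_sym z).
by case: (n == z)%R; case: b; case: c.
Qed.

Lemma uph_shift b (w : word) n : ~~ is_hroot (w, n) && ((false, b) == uph (w, n)) =
  if b then (n < base (val w))%R else (base (val w) < n)%R.
Proof.
rewrite is_hrootE /uph /=; case: (sval w) => [|[z c] u] /=.
  by case: (Order.TotalTheory.ltgtP n 0%R); case: b.
by case: (Order.TotalTheory.ltgtP n z); case: b.
Qed.

(** A letter edge leads rootwards from the end whose word has the extra letter, a shift edge from
    the end farther from [base]. *)
Lemma uphP i v : ~~ is_hroot v && (i == uph v) =
  ~~ (~~ is_hroot (nbh i v) && (opp i == uph (nbh i v))).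
Proof.
case: v => [w n]; case: i => [[] b]; rewrite /nbh /opp /=.
  rewrite !uph_letter negbK; have := valP w; rewrite /=.
  case: (sval w) => [_|a u au] /=; first by rewrite eqxx.
  rewrite (_ : Some a == _ = (a == inv_letter (n, b))) //.
  case: (eqVneq a (inv_letter (n, b))) au => [-> au|_ _]; last by rewrite /= eqxx.
  case: u au => //= c u /andP[]; rewrite inv_letterK => cn _.
  by rewrite (_ : Some c == _ = (c == (n, b))) // cn.
rewrite !uph_shift /=; case: b => /=; lia.
Qed.

Lemma hheight_up v : ~~ is_hroot v -> hheight (nbh (uph v) v) < hheight v.
Proof.
case: v => [w n]; rewrite is_hrootE /uph /hheight /nbh /=.
case: w => [[|[z c] u] wr] /=.
  by case: (Order.TotalTheory.ltgtP n 0%R) => //= n0 _; lia.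
move=> _; case: (Order.TotalTheory.ltgtP n z) => [nz|nz|->] /=; [lia|lia|].
by rewrite /inv_letter /= negbK eqxx; lia.
Qed.

Lemma hub_morph (s : hubs -> hubs) g :
  (forall i v, s (nbh i v) = nbh i (s v)) -> s hroot = (g, 0%R) ->
  forall w n, s (w, n) = (wmul g w, n).
Proof.
move=> sE s0.
suff H v : s v = (wmul g v.1, v.2) by move=> w n; rewrite H.
apply: (@nbh_connected (fun v => s v = (wmul g v.1, v.2))); first by exists hroot.
move=> i {}v vE; rewrite sE vE; case: v {vE} => w n; rewrite /nbh /=.
by case: i.1 => //=; rewrite wmul_rm.
Qed.

(** * Trees attached to labellings of the free group *)

Definition hub_label (a : word -> nat) (v : hubs) : nat :=
  if v.2 == 0%R then a v.1 else 0.

Definition tree_of (a : word -> nat) : sgraph := dtree nbhK (hub_label a).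

Lemma tree_of_is_tree a : is_tree (tree_of a).
Proof. exact: dtree_is_tree is_hrootP uphP hheight_up _. Qed.

Lemma tree_of_locally_finite a : locally_finite (tree_of a).
Proof. exact: dtree_locally_finite. Qed.

Lemma morph_comp (p : word -> word) : (forall c w, p (rm c w) = rm c (p w)) ->
  forall i v, (p (nbh i v).1, (nbh i v).2) = nbh i (p v.1, v.2).
Proof. by move=> pE i [w n]; rewrite /nbh /=; case: i.1; rewrite /= ?pE. Qed.

Lemma tree_of_isomorphic a b c : (forall w, a w = b (lm c w)) ->
  isomorphic (tree_of a) (tree_of b).
Proof.
move=> ab; apply: (@dtree_isomorphic _ _ nbhK _ _ (fun v => (lm c v.1, v.2))).
- exists (fun v => (lm (inv_letter c) v.1, v.2)) => -[w n] /=; by rewrite ?lmK ?lmVK.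
- by apply: morph_comp => b' w; apply: lm_rm.
by move=> [w n]; rewrite /hub_label /= ab.
Qed.

Lemma tree_of_embeds a b : (forall w, a w <= b w) -> embeds (tree_of a) (tree_of b).
Proof.
move=> ab; apply: (@dtree_embeds _ _ nbhK _ _ id) => // -[w n].
by rewrite /hub_label /=; case: ifP.
Qed.

Lemma tree_of_embedsP a b : 0 < a empty -> embeds (tree_of a) (tree_of b) ->
  exists g, forall w, a w <= b (wmul g w).
Proof.
move=> a0 [f fP]; have le := hub_map_label fP.
case E : (hub_map f hroot) => [g n].
(* Only level 0 carries labels, so a positive label at the identity excludes core symmetries that
   shift the levels. *)
have n0 : n = 0%R.
  have := leq_trans a0 (le hroot); rewrite E /hub_label /=.
  by case: (n =P 0%R).
have sE := hub_morph (hub_map_nb fP) (etrans E (congr1 (pair g) n0)).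
by exists g => w; have := le (w, 0%R); rewrite sE.
Qed.

Lemma tree_of_isomorphicP a b : 0 < a empty -> isomorphic (tree_of a) (tree_of b) ->
  exists g, forall w, a w = b (wmul g w).
Proof.
move=> a0 /dtree_isomorphicP[s [sE le ge]].
case E : (s hroot) => [g n].
have n0 : n = 0%R.
  have := leq_trans a0 (le hroot); rewrite E /hub_label /=.
  by case: (n =P 0%R).
have sm := hub_morph sE (etrans E (congr1 (pair g) n0)).
exists g => w; apply/eqP; rewrite eqn_leq.
by have := le (w, 0%R); have := ge (w, 0%R); rewrite sm /hub_label /= => -> ->.
Qed.

Lemma tree_of_sibling a H : 0 < a empty -> equimorphic (tree_of a) H ->
  exists b g, [/\ isomorphic (tree_of b) H, forall w, b w <= a w
    & forall w, a w <= b (wmul g w)].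
Proof.
move=> a0 eqH; have [aH Ha] := eqH.
have [l' [le iso]] := dtree_sibling nbh_connected eqH.
pose b w := l' (w, 0%R).
have isob : isomorphic (tree_of b) H.
  apply: isomorphic_trans iso.
  apply: (@dtree_isomorphic _ _ nbhK _ _ id) => //; first by exists id.
  (* As [l'] lies below [hub_label a], it vanishes off level 0 and thus equals [hub_label b]. *)
  move=> [w n]; rewrite /hub_label /b /=; case: eqP => [->//|n0].
  by have := le (w, n); rewrite /hub_label /=; case: eqP => // _; rewrite leqn0 => /eqP.
have [g gP] : exists g, forall w, a w <= b (wmul g w).
  apply: tree_of_embedsP => //; apply: embeds_trans aH _.
  by apply: isomorphic_embeds; apply: isomorphic_sym.
by exists b, g; split=> // w; apply: leq_trans (le (w, 0%R)) _.
Qed.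

(** * Labellings *)

Section Variation.
Variables (s : nat) (I : choiceType).
Implicit Types (a b c : I -> nat) (X Y : seq I).

(** [j] is the residue of the total of b - a, written additively to stay within the natural
    numbers. *)
Definition variation (j : nat) a b : Prop :=
  exists X, [/\ uniq X, forall x, x \notin X -> a x = b x &
    \sum_(x <- X) a x + j = \sum_(x <- X) b x %[mod s]].

Lemma sum_subset X Y a : uniq X -> uniq Y -> {subset X <= Y} ->
  \sum_(x <- Y) a x = \sum_(x <- X) a x + \sum_(x <- Y | x \notin X) a x.
Proof.
move=> uX uY XY; rewrite (bigID (mem X)) /=; congr addn.
rewrite -big_filter; apply: perm_big; apply: uniq_perm => //.
  by rewrite filter_uniq.
by move=> x; rewrite mem_filter; case: (boolP (x \in X)) => // /XY.
Qed.

Lemma variation_subset X Y j a b : uniq X -> uniq Y -> {subset X <= Y} ->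
  (forall x, x \notin X -> a x = b x) ->
  \sum_(x <- X) a x + j = \sum_(x <- X) b x %[mod s] ->
  \sum_(x <- Y) a x + j = \sum_(x <- Y) b x %[mod s].
Proof.
move=> uX uY XY ab eqs; rewrite !(sum_subset _ uX uY XY) addnAC.
have -> : \sum_(x <- Y | x \notin X) a x = \sum_(x <- Y | x \notin X) b x.
  by apply: eq_bigr => x /ab.
by apply/eqP; rewrite eqn_modDr; apply/eqP.
Qed.

(** Enlarging an exceptional set adds equal summands on both sides, so the union serves both
    pairs. *)
Lemma variation_common j k a b a' b' :
  variation j a b -> variation k a' b' -> exists X, [/\ uniq X,
    forall x, x \notin X -> a x = b x /\ a' x = b' x,
    \sum_(x <- X) a x + j = \sum_(x <- X) b x %[mod s] &
    \sum_(x <- X) a' x + k = \sum_(x <- X) b' x %[mod s]].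
Proof.
move=> [X [uX ab eqX]] [Y [uY ab' eqY]].
have uXY := undup_uniq (X ++ Y); exists (undup (X ++ Y)); split=> //.
- move=> x; rewrite mem_undup mem_cat negb_or => /andP[xX xY].
  by rewrite ab ?ab'.
- by apply: variation_subset ab eqX => // x xX; rewrite mem_undup mem_cat xX.
- by apply: variation_subset ab' eqY => // x xY; rewrite mem_undup mem_cat xY orbT.
Qed.

Lemma variation_sym a b : variation 0 a b -> variation 0 b a.
Proof.
by move=> [X [uX ab eqX]]; exists X; split=> [//|x /ab//|]; rewrite addn0 -eqX addn0.
Qed.

Lemma variation_cancel j a b c :
  variation j a b -> variation j a c -> variation 0 b c.
Proof.
move=> ab bc; have [X [uX off e1 e2]] := variation_common ab bc.
exists X; split=> //; last by rewrite addn0 -e1 e2.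
by move=> x /off[<- <-].
Qed.

Lemma variation_uniq j k a b : variation j a b -> variation k a b -> j = k %[mod s].
Proof.
move=> ab ab'; have [X [_ _ e1 e2]] := variation_common ab ab'.
by apply/eqP; rewrite -(eqn_modDl (\sum_(x <- X) a x)) e1 e2.
Qed.

Lemma variation_trans j a b c : variation j a b -> variation 0 b c -> variation j a c.
Proof.
move=> ab bc; have [X [uX off e1]] := variation_common ab bc.
rewrite addn0 => e2; exists X; split=> //; last by rewrite e1.
by move=> x /off[-> ->].
Qed.

Lemma variation_translate j a b (p : I -> I) : bijective p ->
  variation j a b -> variation j (a \o p) (b \o p).
Proof.
move=> [q pK qK] [X [uX ab eqX]]; exists (map q X); split.
- by rewrite map_inj_uniq //; apply: can_inj qK.
- move=> x xq /=; apply: ab; apply: contra xq => px; apply/mapP.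
  by exists (p x).
by rewrite !big_map /=; under eq_bigr do rewrite qK;
  under [in RHS]eq_bigr do rewrite qK.
Qed.

Lemma variation_eq j a b a' b' : a =1 a' -> b =1 b' ->
  variation j a b -> variation j a' b'.
Proof. by move=> /funext-> /funext->. Qed.

Lemma variation_exists a b X : 0 < s -> (forall x, x \notin X -> a x = b x) ->
  exists2 j, j < s & variation j a b.
Proof.
move=> s0 ab; pose Y := undup X.
(* Multiplication by [s.-1] is negation modulo [s], so this is the total of b - a. *)
exists ((\sum_(x <- Y) b x + s.-1 * \sum_(x <- Y) a x) %% s).
  by rewrite ltn_mod.
exists Y; split; first exact: undup_uniq.
  by move=> x; rewrite mem_undup => /ab.
rewrite modnDmr addnCA -mulSn prednK //.
by rewrite addnC [s * _]mulnC modnMDl.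
Qed.

End Variation.

Lemma wmul_bij g : bijective (wmul g).
Proof.
elim/word_ind: g => [|c g IHg].
  by apply: (@eq_bij _ _ id) => [|w]; [exists id | rewrite wmul0].
apply: (@eq_bij _ _ (wmul g \o lm c)) => [|w]; last by rewrite wmul_rml.
by apply: bij_comp => //; apply: lm_bij.
Qed.

(** * Construction of the labelling *)

Section Labels.
Variable s : nat.
Hypothesis s_gt0 : 0 < s.

Definition rank (a : letter) : nat := `|a.1|.
Definition low (m : nat) (w : word) : bool := all (fun a => rank a < m) (val w).

Fixpoint override (L : seq (word * nat)) (b : word -> nat) (w : word) : nat :=
  if L is (x, k) :: L' then if w == x then k else override L' b w else b w.

(* The unused second component of the code gives each list of changes codes
   above any given bound, so that the filter can be made vacuous. *)
Definition changes (z : int) : seq (word * nat) :=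
  if z is Posz n then
    if (unpickle n : option (seq (word * nat) * nat)) is Some (L, _) then
      [seq p <- L | low n p.1]
    else [::]
  else [::].

Definition changed (z : int) : seq word := undup (unzip1 (changes z)).

Definition target (b : word -> nat) (z : int) : word -> nat := override (changes z) b.

Definition shift_class (b : word -> nat) (z : int) : nat :=
  (\sum_(x <- changed z) b x + s.-1 * \sum_(x <- changed z) target b z x) %% s.

Definition drop_root (b : word -> nat) (j : nat) (w : word) : nat :=
  if w == empty then s - j else b w.

(** A_z and B_z are [source label z] and [target label z]; lowering by [shift_class] makes both fall
    short of [label] by the same residue. *)
Definition source (b : word -> nat) (z : int) : word -> nat :=
  drop_root b (shift_class b z).

(* [stage m] is meaningful only on words whose letters have rank below [m]. *)
Fixpoint stage (m : nat) (w : word) : nat :=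
  if m is m'.+1 then
    (* Words being stored backwards, the first hit is the last letter of rank [m'], and [take] keeps
       what follows it. *)
    let k := find (fun a => rank a == m') (val w) in
    let r := insubd empty (take k (val w)) in
    if ohead (drop k (val w)) is Some a then
      if a.2 then source (stage m') a.1 r else target (stage m') a.1 r
    else stage m' w
  else s.

Definition label (w : word) : nat := stage (\max_(a <- val w) (rank a).+1) w.

Lemma lowW m n w : m <= n -> low m w -> low n w.
Proof. by move=> mn; apply: sub_all => a; move/leq_trans; apply. Qed.

Lemma stage_low m n w : low m w -> m <= n -> stage n w = stage m w.
Proof.
move=> lw; elim: n => [|n IHn]; first by rewrite leqn0 => /eqP->.
rewrite leq_eqVlt => /predU1P[->//|]; rewrite ltnS => mn /=.
rewrite hasNfind ?drop_size ?IHn //.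
apply/hasPn => a aw; have /allP/(_ a aw) := lw; lia.
Qed.

Lemma label_low m w : low m w -> label w = stage m w.
Proof.
move=> lw; have lw' : low (\max_(a <- val w) (rank a).+1) w.
  by apply/allP => a aw; apply: (leq_bigmax_seq (F := fun a => (rank a).+1)).
have /orP[le|le] := leq_total m (\max_(a <- val w) (rank a).+1).
  by rewrite /label (stage_low lw le).
by rewrite /label (stage_low lw' le).
Qed.

Lemma low_empty m : low m empty. Proof. by []. Qed.

Lemma label_empty : label empty = s. Proof. by rewrite (label_low (low_empty 0)). Qed.

Lemma changes_low z p : p \in changes z -> low `|z| p.1.
Proof.
case: z => // n; rewrite /changes; case: unpickle => // -[L _].
by rewrite mem_filter => /andP[].
Qed.

Lemma changed_low z x : x \in changed z -> low `|z| x.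
Proof. by rewrite mem_undup => /mapP[p /changes_low + ->]. Qed.

Lemma override_off L b w : w \notin unzip1 L -> override L b w = b w.
Proof.
elim: L => //= -[x k] L IHL; rewrite in_cons negb_or => /andP[/negbTE-> wL].
exact: IHL.
Qed.

Lemma target_off b z w : w \notin changed z -> target b z w = b w.
Proof. by rewrite mem_undup; apply: override_off. Qed.

Lemma override_eq L b b' w : b w = b' w -> override L b w = override L b' w.
Proof. by move=> bb; elim: L => //= -[x k] L ->. Qed.

(** On words with letters of rank below that of z, which include all of [changed z], the stage
    already has its final value; the recursive equations thus hold for [label] itself. *)
Lemma target_eq z w : low `|z| w -> target (stage `|z|) z w = target label z w.
Proof. by move=> lw; apply: override_eq; rewrite (label_low lw). Qed.

Lemma shift_class_eq z : shift_class (stage `|z|) z = shift_class label z.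
Proof.
rewrite /shift_class; congr ((_ + _ * _) %% s); apply: eq_big_seq => x /changed_low lx.
  by rewrite (label_low lx).
exact: target_eq.
Qed.

Lemma source_eq z w : low `|z| w -> source (stage `|z|) z w = source label z w.
Proof.
by move=> lw; rewrite /source /drop_root shift_class_eq (label_low lw).
Qed.

Lemma source_off z w : ~~ low `|z| w -> source label z w = label w.
Proof. by rewrite /source /drop_root; case: eqP => // ->. Qed.

Lemma target_off_low z w : ~~ low `|z| w -> target label z w = label w.
Proof. by move=> lw; apply: target_off; apply: contra lw; apply: changed_low. Qed.

(** The bounds make [c] the last letter of maximal rank and [r] what follows it, so this is the
    recursion unfolded. *)
Lemma label_split w r c u : val w = val r ++ c :: u -> low (rank c) r ->
  all (fun a => rank a <= rank c) u ->
  label w = if c.2 then source label c.1 r else target label c.1 r.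
Proof.
move=> wE lr lu.
have lw : low (rank c).+1 w.
  rewrite /low wE all_cat /= ltnS leqnn /=; apply/andP; split=> //.
  exact: (lowW (leqnSn _) lr).
rewrite (label_low lw) /= wE find_cat.
have -> : has (fun a => rank a == rank c) (val r) = false.
  by apply/negbTE/hasPn => a /(allP lr); lia.
rewrite /= eqxx addn0 take_size_cat // drop_size_cat //=.
have -> : insubd empty (val r) = r by apply: val_inj; rewrite val_insubd valP.
by case: c.2; [exact: source_eq | exact: target_eq].
Qed.

Lemma top_letter_seq (w : seq letter) : w != [::] -> exists r c u,
  [/\ w = r ++ c :: u, all (fun a => rank a < rank c) r &
      all (fun a => rank a <= rank c) u].
Proof.
elim: w => // a w IHw _; case: (eqVneq w [::]) => [->|/IHw].
  by exists [::], a, [::].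
move=> [r [c [u [-> lr lu]]]]; case: (ltnP (rank a) (rank c)) => [lt|le].
  by exists (a :: r), c, u; rewrite /= lt.
exists [::], a, (r ++ c :: u); split=> //; rewrite all_cat /= le /=.
apply/andP; split; first by apply: sub_all lr => b /=; lia.
by apply: sub_all lu => b /=; lia.
Qed.

Lemma top_letterP w m : ~~ low m w -> exists r c u,
  [/\ val w = val r ++ c :: u, m <= rank c, low (rank c) r &
      all (fun a => rank a <= rank c) u].
Proof.
move=> lw; have w0 : val w != [::] by apply: contraNneq lw; rewrite /low => ->.
have [r [c [u [wE lr lu]]]] := top_letter_seq w0.
have rr : red r by move: (valP w); rewrite /= wE; apply: red_catl.
exists (exist _ r rr), c, u; split=> //.
move: lw; rewrite /low -has_predC => /hasP[b]; rewrite wE mem_cat in_cons /= -leqNgt.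
case/or3P => [/(allP lr)|/eqP->|/(allP lu)] /=; lia.
Qed.

(* Left multiplication keeps the last letter of maximal rank, and what follows
   it, unless this letter is created or cancelled; those two cases hold by the
   choice of [label]. *)
Lemma target_lm z w : target label z (lm (z, true) w) = source label z w.
Proof.
set a := (z, true); have ra : rank a = `|z| by [].
(* If [w] is low, [a] survives in front of it as the only letter of top rank, and the label of the
   product is read off from A_z. *)
case: (boolP (low `|z| w)) => lw.
  have lmE : val (lm a w) = val w ++ [:: a].
    have [wE|[u [b wE]]] : val w = [::] \/ exists u b, val w = rcons u b.
    - by case: (lastP (val w)) => [|u b]; [left | right; exists u, b].
    - by rewrite (val_lm_nil a wE) wE.
    rewrite (val_lm_rcons a wE) cats1 wE; case: eqP => // ba.
    move: lw; rewrite /low wE all_rcons ba => /andP[].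
    by rewrite -[rank _]ra ltnn.
  rewrite target_off_low; first by rewrite (label_split lmE).
  by rewrite /low lmE all_cat /= -ra ltnn andbF.
rewrite (source_off lw); have [r [c [u [wE mc lr lu]]]] := top_letterP lw.
(* As long as [c] and [r] are kept, the label does not change, and B_z agrees with [label] on such
   words. *)
have generic u' : val (lm a w) = val r ++ c :: u' ->
    all (fun b => rank b <= rank c) u' -> target label z (lm a w) = label w.
  move=> lmE lu'; rewrite target_off_low.
    by rewrite (label_split lmE lr lu') (label_split wE lr lu).
  by rewrite /low lmE all_cat /= ltnNge mc andbF.
(* If [u] is empty, [c] is the first letter; when [a] cancels it, [r] remains and [c] is h_z^-1, so
   the label of [w] was B_z(r). Otherwise the change happens in front of [c]. *)
case: (lastP u) wE lu => [|u0 b] wE lu.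
  have wE' : val w = rcons (val r) c by rewrite wE cats1.
  have := val_lm_rcons a wE'; case: eqP => [ca|_] lmE.
    rewrite (label_split wE lr lu) ca /=; congr target.
    exact: val_inj.
  by apply: (generic [:: a]); rewrite ?lmE ?ra /= ?mc // -!cats1 -catA.
have wE' : val w = rcons (val r ++ c :: u0) b by rewrite wE -rcons_cons rcons_cat.
move: lu; rewrite all_rcons => /andP[lb lu].
have := val_lm_rcons a wE'; case: eqP => _ lmE; first exact: generic lmE lu.
apply: (generic (rcons (rcons u0 b) a)); last by rewrite !all_rcons lb lu ra mc.
by rewrite lmE !rcons_cat.
Qed.

(** * Translates and finite modifications of the labelling *)

Lemma drop_root_variation j : j <= s -> variation s j (drop_root label j) label.
Proof.
move=> js; exists [:: empty]; split=> // [x|].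
  by rewrite inE /drop_root => /negbTE->.
by rewrite !big_seq1 /drop_root eqxx label_empty subnK.
Qed.

Lemma shift_class_lt b z : shift_class b z < s.
Proof. by rewrite ltn_mod. Qed.

Lemma target_variation z : variation s (shift_class label z) (target label z) label.
Proof.
exists (changed z); split; [exact: undup_uniq|exact: target_off|].
rewrite /shift_class modnDmr addnCA -mulSn prednK //.
by rewrite addnC [s * _]mulnC modnMDl.
Qed.

(** A_z differs from [label] by the same residue as B_z, hence as the translate A_z of B_z from the
    translate of [label]; the residues cancel. *)
Lemma label_lm c : variation s 0 label (label \o lm c).
Proof.
have pos z : variation s 0 label (label \o lm (z, true)).
  apply: (@variation_cancel _ _ (shift_class label z) (source label z)).
    exact: drop_root_variation (ltnW (shift_class_lt _ _)).
  have := variation_translate (lm_bij (z, true)) (target_variation z).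
  by apply: variation_eq => // w; apply: target_lm.
case: c => z [] //; apply: variation_sym.
have := variation_translate (lm_bij (z, false)) (pos z).
apply: variation_eq => // w /=.
by rewrite -[(z, true)]/(inv_letter (z, false)) lmK.
Qed.

Lemma label_wmul g : variation s 0 label (label \o wmul g).
Proof.
elim/word_ind: g => [|c g IHg].
  by exists [::]; split=> // [x _|]; rewrite /= ?wmul0 ?big_nil.
apply: variation_trans (label_lm c) _.
have := variation_translate (lm_bij c) IHg.
by apply: variation_eq => // w; rewrite /= wmul_rml.
Qed.

Lemma override_graph X (b c : word -> nat) w :
  override [seq (x, b x) | x <- X] c w = if w \in X then b w else c w.
Proof. by elim: X => //= x X ->; rewrite in_cons; case: eqP => //= ->. Qed.

(** Some z encodes exactly the changes from [label] to [b], so B_z is [b]; uniqueness of residues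
    gives [shift_class label z = j], and h_z translates A_z to [b]. *)
Lemma variation_realized j b : j < s -> variation s j b label ->
  isomorphic (tree_of (drop_root label j)) (tree_of b).
Proof.
move=> js bl; have [X [uX off _]] := bl.
pose L := [seq (x, b x) | x <- X].
pose M := \max_(x <- X) \max_(a <- val x) (rank a).+1.
(* Otherwise [M.+1] distinct codes would lie below [M]. A large code makes every changed word low
   for its generator. *)
have [k Mk] : exists k : nat, M <= pickle (L, k).
  apply: contrapT => nk; suff : M.+1 <= M by rewrite ltnn.
  apply: (@leq_inj_bound _ _ (fun k => pickle (L, k)))
    => [k _|k m _ _ /(pcan_inj pickleK)[]//].
  by rewrite ltnNge; apply/negP => Mk; apply: nk; exists k.
pose z := Posz (pickle (L, k)).
have chL : changes z = L.
  rewrite /changes /z pickleK; apply/all_filterP/allP => _ /mapP[x xX ->].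
  apply/allP => a ax; apply: leq_trans Mk.
  apply: leq_trans (leq_bigmax_seq
    (F := fun x : word => \max_(a <- val x) (rank a).+1) x xX isT).
  exact: (leq_bigmax_seq (F := fun a => (rank a).+1)).
have tb : target label z =1 b.
  move=> w; rewrite /target chL override_graph; case: ifP => // /negbT wX.
  by rewrite off.
have jE : shift_class label z = j.
  rewrite -(modn_small js) -(modn_small (shift_class_lt label z)).
  apply: variation_uniq bl; exact: variation_eq tb (frefl _) (target_variation z).
apply: (@tree_of_isomorphic _ _ (z, true)) => w.
by rewrite -tb target_lm /source jE.
Qed.

(** * The s siblings *)

Definition sib (j : nat) : sgraph := tree_of (drop_root label j).

Lemma drop_root_le i j w : j <= i -> drop_root label i w <= drop_root label j w.
Proof. by move=> ji; rewrite /drop_root; case: ifP => // _; rewrite leq_sub2l. Qed.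

Lemma drop_root0 : drop_root label 0 = label.
Proof.
apply/funext => w; rewrite /drop_root; case: eqP => // ->.
by rewrite label_empty subn0.
Qed.

(** Lowering the label at the identity from [s] to 0 is a modification of residue 0, hence yields a
    translate of [label]. *)
Lemma sib0_isomorphic_drop : isomorphic (sib 0) (tree_of (drop_root label s)).
Proof.
apply: variation_realized => //.
have [X [uX off eqX]] := drop_root_variation (leqnn s).
by exists X; split=> //; rewrite -eqX addn0 modnDr.
Qed.

(** [sib j] is squeezed between two copies of [sib 0], with labels [s] and 0 at the identity. *)
Lemma sib_equimorphic j : j < s -> equimorphic (sib 0) (sib j).
Proof.
move=> js; split; last by apply: tree_of_embeds => w; apply: drop_root_le.
apply: embeds_trans (isomorphic_embeds sib0_isomorphic_drop) _.
by apply: tree_of_embeds => w; apply: drop_root_le; apply: ltnW.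
Qed.

(** Translates of [label] differ from it by residue 0, so the residue lost is an isomorphism
    invariant. *)
Lemma sib_inj j k : j < s -> k < s -> isomorphic (sib j) (sib k) -> j = k.
Proof.
move=> js ks /tree_of_isomorphicP; rewrite {1}/drop_root eqxx subn_gt0.
move=> /(_ js)[g gE]; rewrite -(modn_small js) -(modn_small ks).
have vj := variation_trans (drop_root_variation (ltnW js)) (label_wmul g).
apply: variation_uniq vj _.
have := variation_translate (wmul_bij g) (drop_root_variation (ltnW ks)).
by apply: variation_eq => // w; rewrite /= gE.
Qed.

(** The labelling [b] of a sibling is squeezed between [label] and a translate of it. These two
    agree off a finite set, so [b] is a finite modification of [label]. *)
Lemma sib_complete H : equimorphic (sib 0) H -> exists2 j, j < s & isomorphic (sib j) H.
Proof.
rewrite /sib drop_root0 => /tree_of_sibling; rewrite label_empty => /(_ s_gt0).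
move=> [b [g [isoH b_le b_ge]]].
have [X [_ off _]] := label_wmul g.
have [j js bj] : exists2 j, j < s & variation s j b label.
  apply: (variation_exists (X := map (wmul g) X)) => // x xX.
  have [w wE] := bijective_surj (wmul_bij g) x.
  have wX : w \notin X by apply: contra xX => wX; rewrite -wE map_f.
  apply/eqP; rewrite eqn_leq b_le /=; have := off w wX; rewrite /= wE => <-.
  by rewrite -wE b_ge.
exists j => //; exact: isomorphic_trans (variation_realized js bj) isoH.
Qed.

(** Keeping [C] general treats graphs and trees at once. *)
Lemma sib_number (C : set sgraph) : (forall a, C (tree_of a)) ->
  sibling_number_is C (sib 0) s.
Proof.
move=> Ctree; rewrite /sibling_number_is.
have -> : isoclass @` siblings C (sib 0) = (isoclass \o sib) @` `I_s.
  apply/seteqP; split=> [_ [H [_ /sib_complete[j js isoH]] <-]|_ [j js <-]].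
    by exists j => //=; apply/isoclass_eq.
  by exists (sib j) => //; split; [exact: Ctree | exact: sib_equimorphic].
apply: inj_card_eq => j k; rewrite !inE => js ks /isoclass_eq; exact: sib_inj.
Qed.

(** A hub has at least three distinct neighbours, a vertex of a ray at most two. *)
Lemma sib_not_ray j : ~ is_ray (sib j).
Proof.
move=> [f [/bij_inj fI fE]].
pose m i : sib j := mid nbhK (hub_label (drop_root label j)) hroot i.
have ad i : ray_edge (f (hub nbhK _ hroot)) (f (m i)) by apply/fE.
have ne i k : i <> k -> f (m i) <> f (m k) by move=> ik /fI/(congr1 val)[].
have n1 := ne (true, true) (true, false) ltac:(by []).
have n2 := ne (true, true) (false, false) ltac:(by []).
have n3 := ne (true, false) (false, false) ltac:(by []).
have := ad (true, true); have := ad (true, false); have := ad (false, false).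
rewrite /ray_edge; move: n1 n2 n3.
move: (f (m (true, true))) (f (m (true, false))) (f (m (false, false))).
by move: (f _) => /= x y t u; lia.
Qed.

(** The tree embeds into itself through the isomorphic copy with no leaf at the identity hub, so the
    leaves there are missed. *)
Lemma sib_nonsurjective :
  exists f : sib 0 -> sib 0, embedding f /\ ~ set_surj [set: sib 0] [set: sib 0] f.
Proof.
have [f fP] := isomorphic_embeds sib0_isomorphic_drop.
have le v : hub_label (drop_root label s) v <= hub_label (drop_root label 0) (id v).
  by rewrite /hub_label; case: ifP => // _; apply: drop_root_le.
have gP := map_dtree_embedding nbhK (@inj_id _) (fun _ _ => erefl) le.
exists (map_dtree le \o f); split; first exact: embedding_comp fP gP.
have leaf0 : 0 < hub_label (drop_root label 0) hroot.
  by rewrite /hub_label /= drop_root0 label_empty.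
move=> /(_ (@hleaf _ _ nbhK _ _ _ leaf0) I)[x _]; rewrite [(_ \o _) x]/=.
case: {x}(f x) => -[v|v i|v k|v i k] kl /(congr1 val) //= -[vE kE].
by move: kl; rewrite vE kE /hub_label /= /drop_root eqxx subnn.
Qed.

End Labels.

Theorem theorem1p1 :
  (forall s : nat, (0 < s)%N ->
     exists T : sgraph,
       [/\ is_tree T,
           locally_finite T,
           sibling_number_is [set: sgraph] T s
         & sibling_number_is is_tree T s]) /\
  (exists T : sgraph,
     [/\ is_tree T,
         locally_finite T,
         sibling_number_is [set: sgraph] T 1 /\ sibling_number_is is_tree T 1,
         ~ is_ray T
       & exists f : T -> T, embedding f /\ ~ set_surj [set: T] [set: T] f]).
Proof.
have number s (s_gt0 : 0 < s) : sibling_number_is [set: sgraph] (sib s 0) s /\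
    sibling_number_is is_tree (sib s 0) s.
  by split; apply: sib_number => // a; apply: tree_of_is_tree.
split=> [s /number[nG nT]|].
  exists (sib s 0); split=> //; first exact: tree_of_is_tree.
  exact: tree_of_locally_finite.
exists (sib 1 0); split.
- exact: tree_of_is_tree.
- exact: tree_of_locally_finite.
- exact: number.
- exact: sib_not_ray.
- exact: sib_nonsurjective.
Qed.
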